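(* Let $s_2 \ge s_1 \ge 2$ be integers, $s := s_1+s_2$, and let $\mathbb{B}$ be an $s_1$ by $s_2$ bipartite graph. Then there is $n_0$ such that for every $n \ge n_0$, $$\mathrm{ex}(n,(t+1)\mathbb{B}) \le \binom{s(t+1)-1}{2} + \mathrm{ex}\left(n-s(t+1)+1,\mathbb{B}\right) + s_1 s n$$ holds for all integers $t$ satisfying $$\frac{n}{s} - \frac{n}{65 s_1 s^2} \le t \le \frac{n}{s}.$$
   Context: An $s_1$ by $s_2$ bipartite graph is a graph whose vertex set is partitioned into $W_1,W_2$ with $|W_1|=s_1$, $|W_2|=s_2$ and every edge joining $W_1$ and $W_2$. $\mathrm{ex}(n,F)$ is the maximum number of edges in an $n$-vertex graph with no copy of $F$, and $\mathrm{ex}(n,(t+1)F)$ is the maximum number of edges in an $n$-vertex graph not containing $t+1$ pairwise vertex-disjoint copies of $F$. *)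

(* Defs.v *)
From mathcomp Require Import all_boot all_order all_algebra.
Set Implicit Arguments. Unset Strict Implicit. Unset Printing Implicit Defensive.

Definition is_graph (V : finType) (E : {set {set V}}) : bool :=
  [forall e in E, #|e| == 2].

Definition is_copy (VF V : finType) (EF : {set {set VF}}) (E : {set {set V}})
  (f : {ffun VF -> V}) : bool :=
  injectiveb f && [forall e in EF, (f @: e) \in E].

Definition has_copy (VF V : finType) (EF : {set {set VF}}) (E : {set {set V}}) : bool :=
  [exists f : {ffun VF -> V}, is_copy EF E f].

Definition has_disjoint_copies (k : nat) (VF V : finType) (EF : {set {set VF}})
  (E : {set {set V}}) : bool :=
  [exists fs : {ffun 'I_k -> {ffun VF -> V}},
     [forall i, is_copy EF E (fs i)] &&
     [forall i, forall j, (i != j) ==>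
        [disjoint [set fs i x | x : VF] & [set fs j x | x : VF]]]].

Definition ex (n : nat) (VF : finType) (EF : {set {set VF}}) : nat :=
  \max_(E : {set {set 'I_n}} | is_graph E && ~~ has_copy EF E) #|E|.

Definition ex_disj (n k : nat) (VF : finType) (EF : {set {set VF}}) : nat :=
  \max_(E : {set {set 'I_n}} | is_graph E && ~~ has_disjoint_copies k EF E) #|E|.

Definition bipartite_graph (s1 s2 : nat) (V : finType) (W1 W2 : {set V})
  (E : {set {set V}}) : Prop :=
  [/\ is_graph E, W1 :&: W2 = set0, W1 :|: W2 = [set: V] &
      [/\ #|W1| = s1, #|W2| = s2 &
      forall e, e \in E -> exists x y, [/\ x \in W1, y \in W2 & e = [set x; y]]]].

(* Main.v *)
Require Import Defs.
From mathcomp Require Import all_boot all_order all_algebra.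
From mathcomp Require Import zify.
Import Order.TTheory GRing.Theory Num.Theory.

(* Saturate the graph so that it has exactly [t] disjoint copies of [B]; let [C]
   be the set they cover and [R] the rest, which is [B]-free and has
   [r = n - s t] vertices.  For [v] in [C] let [m v] be its number of
   non-neighbours in [C] and [d v] its number of neighbours in [R].  If the bound
   fails, the sum of [2 d - m] over [C] exceeds [2 s1 s n].  Discarding the
   vertices and the copies with [m > 2 d], the remaining "good" vertices send more
   than [s1 s n] edges to [R], so at least [s] vertices of [R] are "rich": they
   have many good neighbours.

   A rich [x] can be exchanged for a covered vertex [u] without losing a copy.
   Choose good neighbours [v_i] ([i < s1]) of [x] in distinct copies [A_i] and
   dissolve one more copy [D].  Its [s] vertices play three roles: [s1] of them
   replace the [v_i] in the [A_i], [s2 - 1] of them form a copy of [B] together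
   with [x] and the [v_i], and the last one is [u].  Most vertices of [C] suit each
   role, because good vertices have few non-neighbours in [C], and averaging over
   the copies [D] and the cyclic rotations of the roles yields a suitable [D].
   Choosing each [u] adjacent to the previous ones, [s] exchanges expose a clique
   of size [s], that is, a [(t+1)]-st copy. *)

Set Implicit Arguments.
Unset Strict Implicit.
Unset Printing Implicit Defensive.

Lemma exists_subset_card (T : finType) (A : {set T}) k :
  k <= #|A| -> exists2 B : {set T}, B \subset A & #|B| = k.
Proof.
case/card_geqP => s [us ss sA]; exists [set x in s].
  by apply/subsetP => x; rewrite inE; apply: sA.
by rewrite cardsE (card_uniqP us).
Qed.

(** * Vertex sets of copies and disjoint packings *)

Section Tiles.

Variables (V : finType) (EB : {set {set V}}) (T : finType) (E : {set {set T}}).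

(** Only the vertex set of a copy is retained: disjointness depends on nothing else, and a copy can
    be re-embedded freely on the same vertices. *)
Definition tile (S : {set T}) : bool :=
  [exists f : {ffun V -> T}, is_copy EB E f && (S == [set f x | x : V])].

(** The region [X] makes packings composable: packings in disjoint regions add up. *)
Definition packs (k : nat) (X : {set T}) : Prop :=
  exists P : {set {set T}},
    [/\ #|P| = k, trivIset P, cover P \subset X & {in P, forall S, tile S}].

Lemma tileP (S : {set T}) :
  reflect (exists2 f : {ffun V -> T}, is_copy EB E f & S = [set f x | x : V])
          (tile S).
Proof.
apply: (iffP existsP) => [[f /andP[fc /eqP]] | [f fc ->]]; first by exists f.
by exists f; rewrite fc eqxx.
Qed.

Lemma card_tile (S : {set T}) : tile S -> #|S| = #|V|.
Proof. by case/tileP => f /andP[/injectiveP f_inj _] ->; rewrite card_imset. Qed.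

Lemma packs_sub k (X Y : {set T}) : X \subset Y -> packs k X -> packs k Y.
Proof.
move=> sXY [P [cP tP sP PP]]; exists P; split=> //.
exact: subset_trans sP sXY.
Qed.

Hypothesis V_gt0 : 0 < #|V|.

(** Nonempty disjoint tiles are distinct, so the cardinality of a family of disjoint tiles really
    counts copies. *)
Lemma tile_neq0 (S : {set T}) : tile S -> S != set0.
Proof. by move/card_tile => cS; rewrite -card_gt0 cS. Qed.

Lemma packsU k l (X Y : {set T}) :
  [disjoint X & Y] -> packs k X -> packs l Y -> packs (k + l) (X :|: Y).
Proof.
move=> dXY [P [cP tP sP PP]] [Q [cQ tQ sQ QQ]].
have inX (A : {set T}) : A \in P -> A \subset X.
  by move=> AP; apply: subset_trans sP; apply: (bigcup_max A).
have inY (A : {set T}) : A \in Q -> A \subset Y.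
  by move=> AP; apply: subset_trans sQ; apply: (bigcup_max A).
have dPQ (A B : {set T}) : A \in P -> B \in Q -> [disjoint A & B].
  by move=> AP BQ; apply: disjointWl (inX _ AP) _; apply: disjointWr (inY _ BQ) _.
exists (P :|: Q); split.
- rewrite cardsU cP cQ; suff -> : P :&: Q = set0 by rewrite cards0 subn0.
  apply/setP=> A; rewrite !inE; apply/negP => /andP[AP AQ].
  have := dPQ _ _ AP AQ; rewrite -setI_eq0 setIid => A0.
  by have := tile_neq0 (PP _ AP); rewrite A0.
- apply/trivIsetP => A B; rewrite !inE.
  move/trivIsetP: tP => tP; move/trivIsetP: tQ => tQ.
  case/orP=> HA; case/orP=> HB AB; first exact: tP.
  + exact: dPQ.
  + by rewrite disjoint_sym dPQ.
  + exact: tQ.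
- apply/bigcupsP => A; rewrite inE => /orP[/inX | /inY] sA.
    exact: subset_trans sA (subsetUl _ _).
  exact: subset_trans sA (subsetUr _ _).
- by move=> A; rewrite inE => /orP[/PP | /QQ].
Qed.

Lemma packs_tiles (I : finType) (S : I -> {set T}) (X : {set T}) :
  (forall i, tile (S i)) -> (forall i, S i \subset X) ->
  (forall i j, i != j -> [disjoint S i & S j]) ->
  packs #|I| X.
Proof.
move=> tS sS dS; exists [set S i | i : I]; split.
- rewrite card_imset // => i j eS; apply/eqP/negPn/negP => /dS.
  by rewrite eS -setI_eq0 setIid => /negPn; rewrite tile_neq0.
- apply/trivIsetP => _ _ /imsetP[i _ ->] /imsetP[j _ ->] nS.
  by apply: dS; apply: contraNneq nS => ->.
- by apply/bigcupsP => _ /imsetP[i _ ->].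
- by move=> _ /imsetP[i _ ->].
Qed.

Lemma packs1 (S X : {set T}) : tile S -> S \subset X -> packs 1 X.
Proof.
move=> tS sS; rewrite -card_unit.
by apply: (@packs_tiles unit (fun=> S)) => // [] [] [].
Qed.

Lemma packs_disjoint_copies k : has_disjoint_copies k EB E <-> packs k setT.
Proof.
split=> [/existsP[fs /andP[/forallP cfs dfs]] | [P [cP tP _ PP]]].
  rewrite -[k in packs k]card_ord.
  apply: (@packs_tiles 'I_k (fun i => [set fs i x | x : V])) => // i.
    by apply/tileP; exists (fs i).
  by move=> j ij; move/forallP: dfs => /(_ i) /forallP /(_ j); rewrite ij.
(* With [k] replaced by [#|P|], the enumeration of [P] indexes the copies. *)
case: _ / cP.
have tile_f (i : 'I_#|P|) : exists f : {ffun V -> T},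
    is_copy EB E f /\ enum_val i = [set f x | x : V].
  by have /tileP[f] := PP _ (enum_valP i); exists f.
have [fs fsP] := fin_all_exists tile_f.
apply/existsP; exists [ffun i => fs i]; apply/andP; split.
  by apply/forallP => i; rewrite ffunE; case: (fsP i).
apply/forallP => i; apply/forallP => j; apply/implyP => ij; rewrite !ffunE.
have [_ <-] := fsP i; have [_ <-] := fsP j.
move/trivIsetP: tP; apply; rewrite ?enum_valP //.
by apply: contraNneq ij => /enum_val_inj ->.
Qed.

End Tiles.

(** * Building copies by vertex replacement and from bicliques *)

Lemma exists_bijection_on (V T : finType) (y0 : T) (A : {set V}) (B : {set T}) :
  #|A| = #|B| -> exists f : V -> T, {in A &, injective f} /\ f @: A = B.
Proof.
move=> cAB; exists (fun x => nth y0 (enum B) (index x (enum A))).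
have sz x : x \in A -> index x (enum A) < size (enum B).
  by move=> xA; rewrite -cardE -cAB cardE index_mem mem_enum.
have inj : {in A &, injective (fun x => nth y0 (enum B) (index x (enum A)))}.
  move=> x y xA yA /eqP; rewrite nth_uniq ?enum_uniq ?sz // => /eqP ixy.
  by rewrite -(nth_index x (s := enum A) (x := x)) ?mem_enum // ixy nth_index ?mem_enum.
split=> //; apply/eqP; rewrite eqEcard card_in_imset // cAB leqnn andbT.
by apply/subsetP => _ /imsetP[x xA ->]; rewrite -mem_enum mem_nth ?sz.
Qed.

Lemma imset_pair (V T : finType) (f : V -> T) (x y : V) :
  f @: [set x; y] = [set f x; f y].
Proof. by rewrite imsetU1 imset_set1. Qed.

Section Constructions.

Variables (s1 s2 : nat) (V : finType) (W1 W2 : {set V}) (EB : {set {set V}}).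
Hypothesis bipB : bipartite_graph s1 s2 W1 W2 EB.
Variables (T : finType) (E : {set {set T}}).

Lemma bip_card : #|V| = s1 + s2.
Proof.
case: bipB => _ dW uW [<- <- _].
by rewrite -cardsT -uW cardsU dW cards0 subn0.
Qed.

Lemma bip_edge_neq (x y : V) : x \in W1 -> y \in W2 -> x != y.
Proof.
case: bipB => _ dW _ _ xW yW; apply/eqP => exy.
by move/setP/(_ x): dW; rewrite !inE xW exy yW.
Qed.

(** Redirect to [z] the vertex [p] embedded at [v]. An edge of [B] contains [p] at most once, so its
    other end stays in [A :\ v], where [z] is adjacent to everything; edges avoiding [p] are
    unchanged. *)
Lemma tile_swap (A : {set T}) (v z : T) :
  tile EB E A -> v \in A -> z \notin A ->
  (forall a, a \in A -> a != v -> [set z; a] \in E) ->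
  tile EB E (z |: (A :\ v)).
Proof.
move=> /tileP[f /andP[/injectiveP f_inj /forall_inP fE] ->] /imsetP[p _ ->] zA zE.
have fz q : f q != z by apply: contraNneq zA => <-; apply: imset_f.
pose g := [ffun q => if q == p then z else f q].
apply/tileP; exists g.
  apply/andP; split.
    apply/injectiveP => a b; rewrite !ffunE.
    have [->|na] := eqVneq a p; have [->|nb] := eqVneq b p => //.
    - by move=> e; have := fz b; rewrite -e eqxx.
    - by move=> e; have := fz a; rewrite e eqxx.
    - exact: f_inj.
  apply/forall_inP => e eEB; have fe := fE _ eEB.
  case: (bipB) => _ _ _ [_ _ /(_ _ eEB) [x [y [xW yW exy]]]].
  have nxy := bip_edge_neq xW yW.
  move: fe; rewrite exy !imset_pair !ffunE.
  have [ex|nx] := eqVneq x p; have [ey|ny] := eqVneq y p => // _.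
  - by case/eqP: nxy; rewrite ex ey.
  - by apply: zE; [apply: imset_f | apply: contraNneq ny => /f_inj ->].
  - rewrite setUC; apply: zE; first exact: imset_f.
    by apply: contraNneq nx => /f_inj ->.
apply/setP => w; rewrite !inE; apply/idP/imsetP.
  case/orP=> [/eqP -> | /andP[wp /imsetP[q _ ew]]].
    by exists p => //; rewrite ffunE eqxx.
  by exists q => //; rewrite ffunE; case: eqVneq => // eq; rewrite ew eq eqxx in wp.
case=> q _ ->; rewrite ffunE; have [_|nq] := eqVneq q p; first by rewrite eqxx.
by rewrite (inj_eq f_inj) nq imset_f ?orbT.
Qed.

Lemma tile_biclique (X1 X2 : {set T}) :
  0 < s1 -> #|X1| = s1 -> #|X2| = s2 -> [disjoint X1 & X2] ->
  (forall x y, x \in X1 -> y \in X2 -> [set x; y] \in E) ->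
  tile EB E (X1 :|: X2).
Proof.
move=> s1_gt0 cX1 cX2 dX XE.
case: (bipB) => _ dW uW [cW1 cW2 eB].
(* [y0] only serves as the default value in the list lookups that define the two bijections. *)
have /card_gt0P[y0 _] : 0 < #|X1| by rewrite cX1.
have [f1 [f1_inj f1X]] : exists f, {in W1 &, injective f} /\ f @: W1 = X1.
  by apply: exists_bijection_on => //; rewrite cX1.
have [f2 [f2_inj f2X]] : exists f, {in W2 &, injective f} /\ f @: W2 = X2.
  by apply: exists_bijection_on => //; rewrite cX2.
have inW x : x \notin W1 -> x \in W2.
  by move=> nx; have := in_setT x; rewrite -uW inE (negPf nx).
have W12 x : x \in W2 -> x \notin W1.
  by move=> xW; apply/negP => xW1; have := bip_edge_neq xW1 xW; rewrite eqxx.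
have h1 x : x \in W1 -> f1 x \in X1 by rewrite -f1X; apply: imset_f.
have h2 x : x \in W2 -> f2 x \in X2 by rewrite -f2X; apply: imset_f.
have ne x y : x \in X1 -> y \in X2 -> x != y.
  by move=> xX yX; apply: contraTneq yX => <-; rewrite (disjointFr dX xX).
pose f := [ffun x => if x \in W1 then f1 x else f2 x].
apply/tileP; exists f.
  apply/andP; split.
    apply/injectiveP => a b; rewrite !ffunE.
    case: ifPn => aW; case: ifPn => bW.
    - exact: f1_inj.
    - by move=> e; have := ne _ _ (h1 _ aW) (h2 _ (inW _ bW)); rewrite e eqxx.
    - by move=> e; have := ne _ _ (h1 _ bW) (h2 _ (inW _ aW)); rewrite e eqxx.
    - by apply: f2_inj; apply: inW.
  apply/forall_inP => e /eB [x [y [xW yW ->]]].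
  rewrite imset_pair !ffunE xW (negPf (W12 _ yW)).
  by apply: XE; [apply: h1 | apply: h2].
apply/setP => w; rewrite inE; apply/idP/imsetP.
  rewrite -f1X -f2X => /orP[] /imsetP[x xW ->]; exists x; rewrite // ffunE.
    by rewrite xW.
  by rewrite (negPf (W12 _ xW)).
case=> x _ ->; rewrite ffunE; case: ifPn => xW; first by rewrite h1.
by rewrite h2 ?orbT ?inW.
Qed.

Lemma tile_clique (U : {set T}) :
  0 < s1 -> #|U| = s1 + s2 ->
  {in U &, forall x y, x != y -> [set x; y] \in E} -> tile EB E U.
Proof.
move=> s1_gt0 cU UE.
have [X1 sX1 cX1] := exists_subset_card (leq_trans (leq_addr s2 s1) (eq_leq (esym cU))).
rewrite -(setID U X1) (setIidPr sX1); apply: tile_biclique => //.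
- by have := cardsID X1 U; rewrite (setIidPr sX1) cX1 cU => /addnI.
- by rewrite disjoint_sym disjoints_subset setDE subsetIr.
move=> x y xX; rewrite inE => /andP[yX yU].
by apply: UE => //; [apply: (subsetP sX1) | apply: contraNneq yX => <-].
Qed.

End Constructions.

(** * Double counting and edge counts in induced subgraphs *)

Lemma double_count (I J : finType) (A : {set I}) (B : {set J}) (r : I -> J -> bool) :
  \sum_(i in A) #|[set j in B | r i j]| = \sum_(j in B) #|[set i in A | r i j]|.
Proof.
have cnt (K : finType) (D : {set K}) (P : pred K) :
    #|[set k in D | P k]| = \sum_(k in D) P k.
  rewrite -sum1_card (eq_bigl (fun k => (k \in D) && P k)) => [|k]; last by rewrite !inE.
  by rewrite big_mkcondr; apply: eq_bigr => k _; case: (P k).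
under eq_bigr do rewrite cnt.
by rewrite exchange_big /=; apply: eq_bigr => j _; rewrite cnt.
Qed.

Lemma card_bigcup_leq (I T : finType) (A : {set I}) (F : I -> {set T}) :
  #|\bigcup_(i in A) F i| <= \sum_(i in A) #|F i|.
Proof.
elim/big_ind2: _ => [|X1 n1 X2 n2 le1 le2|//]; first by rewrite cards0.
by apply: leq_trans (leq_add le1 le2); rewrite leq_card_setU.
Qed.

Section Edges.

Variables (T : finType) (E : {set {set T}}).
Hypothesis gE : is_graph E.

Definition induced (X : {set T}) : {set {set T}} := [set e in E | e \subset X].
Definition nbrs (X : {set T}) (v : T) : {set T} := [set w in X | [set v; w] \in E].
(** The vertex [v] itself is excluded, so the neighbours and non-neighbours of [v] partition
    [X :\ v]. *)
Definition nonnbrs (X : {set T}) (v : T) : {set T} :=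
  [set w in X | (w != v) && ([set v; w] \notin E)].

Lemma graph_edge e : e \in E -> exists x y, x != y /\ e = [set x; y].
Proof. by move=> /(forall_inP gE) /cards2P [x [y [nxy ->]]]; exists x, y. Qed.

Lemma graph_loopless v : [set v; v] \notin E.
Proof. by apply/negP => /(forall_inP gE); rewrite setUid cards1. Qed.

Lemma nbrs_sub (X : {set T}) v : nbrs X v \subset X.
Proof. by apply/subsetP => w; rewrite inE => /andP[]. Qed.

Lemma card_nbrs_nonnbrs (X : {set T}) v : v \in X -> #|nbrs X v| + #|nonnbrs X v| + 1 = #|X|.
Proof.
move=> vX; rewrite (cardsD1 v X) vX addnC; congr (_ + _).
rewrite -cardsUI (_ : _ :&: _ = set0) ?cards0 ?addn0; last first.
  by apply/setP => w; rewrite !inE; case: (_ \in E); rewrite ?andbF.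
apply: eq_card => w; rewrite !inE -andb_orr.
have [->|nwv] := eqVneq w v; first by rewrite (negPf (graph_loopless v)) andbF.
by case: (_ \in E); rewrite ?andbT.
Qed.

(** The handshake count: [w] corresponds to the edge [[set v; w]], and each edge is seen from both
    ends. *)
Lemma sum_nbrs (X : {set T}) : \sum_(v in X) #|nbrs X v| = 2 * #|induced X|.
Proof.
have deg v : v \in X -> #|nbrs X v| = #|[set e in induced X | v \in e]|.
  move=> vX; rewrite -(card_in_imset (f := fun w => [set v; w])).
    apply: eq_card => e; rewrite !inE; apply/imsetP/idP.
      case=> w; rewrite inE => /andP[wX wE] ->.
      by rewrite wE !inE eqxx subUset !sub1set vX wX.
    case/andP=> /andP[eE eX] ve.
    have [x [y [nxy exy]]] := graph_edge eE.
    move: ve eX eE; rewrite exy !inE subUset !sub1set => /orP[] /eqP -> /andP[xX yX] eE.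
      by exists y; rewrite ?inE ?yX.
    by exists x; rewrite ?inE ?xX 1?setUC.
  move=> a b; rewrite !inE => /andP[_ aE] /andP[_ bE] eab.
  have : a \in [set v; b] by rewrite -eab !inE eqxx orbT.
  rewrite !inE => /orP[/eqP av | /eqP //].
  by move: aE; rewrite av (negPf (graph_loopless v)).
rewrite (eq_bigr _ deg) double_count -sum1_card mulnC big_distrl /=.
apply: eq_bigr => e; rewrite inE mul1n => /andP[eE eX].
rewrite -[RHS](eqP (forall_inP gE _ eE)); apply: eq_card => v.
by rewrite inE andb_idl //; apply: (subsetP eX).
Qed.

(** The handshake count with each degree written as [#|X| - 1] minus the number of non-neighbours.
    It measures exactly how far [X] is from a clique, doubled to avoid a division. *)
Lemma card_induced (X : {set T}) :
  2 * #|induced X| + \sum_(v in X) #|nonnbrs X v| = #|X| * (#|X| - 1).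
Proof.
rewrite -sum_nbrs -big_split /= (eq_bigr (fun=> #|X| - 1)); last first.
  by move=> v /card_nbrs_nonnbrs <-; rewrite addnK.
by rewrite sum_nat_const.
Qed.

Lemma card_induced_split (X Y : {set T}) :
  #|induced (X :|: Y)| <= #|induced X| + #|induced Y| + \sum_(v in X) #|nbrs Y v|.
Proof.
have -> : \sum_(v in X) #|nbrs Y v| = \sum_(v in X) #|[set [set v; w] | w in nbrs Y v]|.
  apply: eq_bigr => v _; rewrite card_in_imset // => a b.
  rewrite !inE => /andP[_ aE] /andP[_ bE] eab.
  have : a \in [set v; b] by rewrite -eab !inE eqxx orbT.
  rewrite !inE => /orP[/eqP av | /eqP //].
  by move: aE; rewrite av (negPf (graph_loopless v)).
apply: leq_trans (leq_add (leqnn _) (card_bigcup_leq _ _)).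
apply: leq_trans (leq_add (leq_card_setU _ _) (leqnn _)).
apply: leq_trans (leq_card_setU _ _).
apply: subset_leq_card; apply/subsetP => e; rewrite !inE => /andP[eE].
have [x [y [nxy exy]]] := graph_edge eE.
rewrite eE exy !subUset !sub1set !inE.
have hx a b : e = [set a; b] -> a \in X -> b \in Y ->
    [set x; y] \in \bigcup_(i in X) [set [set i; w] | w in nbrs Y i].
  move=> eab aX bY; apply/bigcupP; exists a => //; apply/imsetP; exists b; rewrite -?exy //.
  by rewrite inE bY -eab.
case/andP=> /orP[] xX /orP[] yX; rewrite xX yX ?orbT //=.
- by rewrite (hx x y) ?orbT.
- by rewrite (hx y x) ?orbT // setUC.
Qed.

(** Each vertex removed from [X] destroys at most [#|X|] edges. *)
Lemma card_induced_leq (X Y : {set T}) : Y \subset X ->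
  #|induced X| <= #|induced Y| + (#|X| - #|Y|) * #|X|.
Proof.
move=> sYX; have -> : #|X| - #|Y| = #|X :\: Y|.
  by rewrite cardsD (setIidPr sYX).
rewrite -sum_nat_const.
pose F v := [set [set v; w] | w in X].
apply: (@leq_trans (#|induced Y| + \sum_(v in X :\: Y) #|F v|)); last first.
  by rewrite leq_add2l; apply: leq_sum => v _; apply: leq_imset_card.
apply: leq_trans (leq_add (leqnn _) (card_bigcup_leq _ _)).
apply: leq_trans (leq_card_setU _ _).
apply: subset_leq_card; apply/subsetP => e; rewrite !inE => /andP[eE eX].
have [x [y [nxy exy]]] := graph_edge eE.
move: eX; rewrite eE exy /= !subUset !sub1set => /andP[xX yX].
case: (boolP (x \in Y)) => [xY|nxY]; last first.
  apply/orP; right; apply/bigcupP; exists x; first by rewrite inE nxY.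
  by apply: imset_f.
case: (boolP (y \in Y)) => [//|nyY].
apply/orP; right; apply/bigcupP; exists y; first by rewrite inE nyY.
by rewrite setUC; apply: imset_f.
Qed.

Lemma induced_setT : induced setT = E.
Proof. by apply/setP => e; rewrite !inE subsetT andbT. Qed.

(** Since [ex] speaks of graphs on ordinals, the induced graph is pulled back along the enumeration
    of [X]; a copy there would push forward to a tile inside [X]. *)
Lemma card_induced_ex (V : finType) (EB : {set {set V}}) (X : {set T}) :
  (forall S : {set T}, S \subset X -> ~~ tile EB E S) -> #|induced X| <= ex #|X| EB.
Proof.
move=> noS; pose g (i : 'I_#|X|) : T := enum_val i.
have g_inj : injective g by apply: enum_val_inj.
pose E' := [set e : {set 'I_#|X|} | g @: e \in E].
apply: (@leq_trans #|E'|).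
  rewrite -(card_imset _ (imset_inj g_inj)); apply: subset_leq_card.
  apply/subsetP => e; rewrite inE => /andP[eE eX]; apply/imsetP.
  have ge : g @: (g @^-1: e) = e.
    apply/setP => x; apply/imsetP/idP => [[i] | xe]; first by rewrite inE => ? ->.
    have xX := subsetP eX x xe; exists (enum_rank_in xX x).
      by rewrite inE /g enum_rankK_in.
    by rewrite /g enum_rankK_in.
  by exists (g @^-1: e); rewrite ?inE ge.
rewrite /ex; apply: (bigop.bigmax_sup E') => //.
apply/andP; split.
  apply/forall_inP => e; rewrite inE => /(forall_inP gE).
  by rewrite card_imset.
apply/negP => /existsP[f /andP[/injectiveP f_inj /forall_inP fE]].
pose h := [ffun x => g (f x)].
have sX : [set h x | x : V] \subset X.
  by apply/subsetP => _ /imsetP[x _ ->]; rewrite ffunE enum_valP.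
have /negP := noS _ sX; apply; apply/tileP; exists h => //; apply/andP; split.
  by apply/injectiveP => a b; rewrite !ffunE => /g_inj /f_inj.
apply/forall_inP => e /fE; rewrite inE -imset_comp.
by rewrite (eq_imset (g := h)) // => x; rewrite ffunE.
Qed.

End Edges.

(** * Labelling the vertices of a block so as to avoid bad sets *)

Lemma trivIset_eq (T : finType) (P : {set {set T}}) (A B : {set T}) (x : T) :
  trivIset P -> A \in P -> B \in P -> x \in A -> x \in B -> A = B.
Proof.
move=> tP AP BP xA xB; rewrite -(def_pblock tP AP xA).
exact: def_pblock.
Qed.

(* Averaging over the pairs of a block and a rotation of a fixed enumeration of it:
   for each role, distinct pairs give that role distinct points. *)
Lemma cyclic_labelling (T : finType) m (P : {set {set T}}) (bad : 'I_m.+1 -> {set T}) :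
  trivIset P -> {in P, forall D : {set T}, #|D| = m.+1} ->
  \sum_i #|bad i| < m.+1 * #|P| ->
  exists D (w : 'I_m.+1 -> T),
    [/\ D \in P, injective w, forall i, w i \in D & forall i, w i \notin bad i].
Proof.
move=> tP cP lt_bad.
have [y0 _] : exists y0 : T, true.
  case: (set_0Vmem P) => [P0 | [D DP]]; first by move: lt_bad; rewrite P0 cards0 muln0.
  by have /card_gt0P[y _] : 0 < #|D| by rewrite cP //; exists y.
pose e (D : {set T}) (i : 'I_m.+1) := nth y0 (enum D) i.
have eD (D : {set T}) i : D \in P -> e D i \in D.
  by move=> DP; rewrite -mem_enum mem_nth // -cardE cP.
have e_inj (D : {set T}) : D \in P -> injective (e D).
  move=> DP i j /eqP; rewrite nth_uniq ?enum_uniq -?cardE ?cP // => /eqP.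
  exact: val_inj.
(* Addition in ['I_m.+1] is modulo [m.+1], so the second component of a pair acts as a rotation.
   [F i] collects the pairs that put a bad point in role [i]. *)
pose Z := setX P [set: 'I_m.+1].
pose F i := [set Dk in Z | e Dk.1 (i + Dk.2)%R \in bad i].
have cF i : #|F i| <= #|bad i|.
  rewrite -(card_in_imset (f := fun Dk => e Dk.1 (i + Dk.2)%R)).
    apply/subset_leq_card/subsetP => _ /imsetP[Dk DkF ->].
    by move: DkF; rewrite inE => /andP[].
  move=> [D k] [D' k']; rewrite !inE /= => /andP[/andP[DP _] _] /andP[/andP[DP' _] _] eq.
  have eDD : D = D'.
    by apply: (trivIset_eq tP DP DP' (eD _ (i + k)%R DP)); rewrite eq eD.
  by move: eq; rewrite -eDD => /(e_inj _ DP) /GRing.addrI ->.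
(* The pairs failing in some role are fewer than all pairs, so some pair fails in none. *)
have : #|\bigcup_(i in [set: 'I_m.+1]) F i| < #|Z|.
  apply: leq_ltn_trans (card_bigcup_leq _ _) _.
  rewrite cardsX cardsT card_ord mulnC; apply: leq_ltn_trans lt_bad.
  rewrite big_mkcond; apply: leq_sum => i _; rewrite inE; exact: cF.
rewrite ltnNge => /negP nZ.
have /subsetPn [[D k]] : ~~ (Z \subset \bigcup_(i in [set: 'I_m.+1]) F i).
  by apply/negP => /subset_leq_card.
rewrite !inE /= => /andP[DP _] nF; exists D, (fun i => e D (i + k)%R); split=> //.
- by move=> i j /(e_inj _ DP) /GRing.addIr.
- by move=> i; apply: eD.
move=> i; apply: contra nF => b; apply/bigcupP; exists i; first exact: in_setT.
by rewrite !inE /= DP.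
Qed.

(** * The exchange gadget *)

Section Gadget.

Variables (s1 s2 : nat) (V : finType) (W1 W2 : {set V}) (EB : {set {set V}}).
Hypothesis bipB : bipartite_graph s1 s2 W1 W2 EB.
Hypotheses (s1_gt0 : 0 < s1) (s2_gt0 : 0 < s2).
Variables (T : finType) (E : {set {set T}}).

(** The [s1.+1] new tiles are the [A i] with [v i] replaced by [z i], and the biclique with the
    freed [v i] on one side and [x] with the [y k] on the other. Counted together with [D], the
    [A i] were also [s1.+1] tiles, so bringing in [x] frees [u] at no loss. *)
Lemma gadget (P : {set {set T}}) (A : 'I_s1 -> {set T}) (D : {set T})
    (v z : 'I_s1 -> T) (y : 'I_s2.-1 -> T) (x u : T) :
  trivIset P -> {in P, forall S : {set T}, tile EB E S} ->
  injective A -> (forall i, A i \in P) -> D \in P -> (forall i, A i != D) ->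
  (forall i, v i \in A i) -> x \notin cover P ->
  injective z -> injective y -> (forall i k, z i != y k) ->
  (forall i, z i != u) -> (forall k, y k != u) ->
  (forall i, z i \in D) -> (forall k, y k \in D) -> u \in D ->
  (forall i a, a \in A i -> a != v i -> [set z i; a] \in E) ->
  (forall i, [set v i; x] \in E) ->
  (forall i k, [set v i; y k] \in E) ->
  packs EB E s1.+1 ((x |: (\bigcup_i A i :|: D)) :\ u).
Proof.
move=> tP tiles_P A_inj AP DP AD vA xP z_inj y_inj zy zu yu zD yD uD zA xv yv.
have inA i j a : a \in A i -> a \in A j -> i = j.
  by move=> ai aj; apply: A_inj; apply: (trivIset_eq tP (AP i) (AP j) ai aj).
have inAD i a : a \in A i -> a \in D -> False.
  by move=> ai aD; have := AD i; rewrite (trivIset_eq tP (AP i) DP ai aD) eqxx.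
have xA i : x \notin A i.
  by apply: contra xP => xA; apply/bigcupP; exists (A i).
have xD : x \notin D by apply: contra xP => xD; apply/bigcupP; exists D.
have v_inj : injective v by move=> i j eq; apply: (inA i j (v i)); rewrite ?vA // eq vA.
have neAD i a b : a \in A i -> b \in D -> a != b.
  by move=> aA bD; apply/eqP => eq; apply: (inAD i a); rewrite // eq.
have nevD i b : b \in D -> v i != b by apply: neAD.
have nxD b : b \in D -> x != b by move=> bD; apply: contraNneq xD => ->.
pose K1 := [set v i | i : 'I_s1].
pose K2 := x |: [set y k | k : 'I_s2.-1].
pose S i := z i |: (A i :\ v i).
have tS i : tile EB E (S i).
  apply: (tile_swap bipB (tiles_P _ (AP i)) (vA i)); last exact: zA.
  by apply/negP => /inAD; apply.
have tK : tile EB E (K1 :|: K2).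
  apply: (tile_biclique bipB) => //.
  - by rewrite card_imset // card_ord.
  - rewrite cardsU1 card_imset // card_ord.
    rewrite (_ : x \notin _); first by rewrite add1n prednK.
    by apply/negP => /imsetP[k _ e]; have := nxD _ (yD k); rewrite -e eqxx.
  - rewrite -setI_eq0; apply/eqP/setP => b; rewrite !inE; apply/negP.
    case/andP=> /imsetP[i _ ->] /orP[/eqP e | /imsetP[k _ e]].
      by have := xA i; rewrite -e vA.
    by have := nevD i _ (yD k); rewrite e eqxx.
  move=> _ b /imsetP[i _ ->]; rewrite !inE => /orP[/eqP -> // | /imsetP[k _ ->]].
  exact: yv.
have SK i : [disjoint S i & K1 :|: K2].
  rewrite -setI_eq0; apply/eqP/setP => b; rewrite !inE; apply/negP.
  case/andP=> /orP[/eqP -> | /andP[nb bA]] /or3P[].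
  - by case/imsetP=> j _ e; have := nevD j _ (zD i); rewrite e eqxx.
  - by move/eqP => e; have := nxD _ (zD i); rewrite e eqxx.
  - by case/imsetP=> k _ e; have := zy i k; rewrite e eqxx.
  - case/imsetP=> j _ e; have ji : j = i by apply: (inA _ _ (v j)); rewrite ?vA // -e.
    by rewrite e ji eqxx in nb.
  - by move/eqP => e; have := xA i; rewrite -e bA.
  - by case/imsetP=> k _ e; apply: (inAD i b); rewrite // e.
have SS i j : i != j -> [disjoint S i & S j].
  move=> ij; rewrite -setI_eq0; apply/eqP/setP => b; rewrite !inE; apply/negP.
  case/andP=> /orP[/eqP -> | /andP[_ bi]] /orP[/eqP e | /andP[_ bj]].
  - by rewrite (z_inj _ _ e) eqxx in ij.
  - exact: (inAD j (z i)).
  - by apply: (inAD i b); rewrite // e.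
  - by rewrite (inA _ _ _ bi bj) eqxx in ij.
rewrite -addn1 -[s1 in packs _ _ (s1 + 1)]card_ord.
have V_gt0 : 0 < #|V| by rewrite (bip_card bipB) ltn_addr.
apply: (@packs_sub _ _ _ _ _ (\bigcup_i S i :|: (K1 :|: K2))).
  apply/subsetP => b; rewrite 2!inE => /orP[/bigcupP[i _] | ].
    rewrite !inE => /orP[/eqP -> | /andP[_ bA]]; first by rewrite zu zD !orbT.
    rewrite (neAD _ _ _ bA uD) /=; apply/orP; right; apply/orP; left.
    by apply/bigcupP; exists i.
  rewrite !inE => /or3P[/imsetP[i _ ->] | /eqP -> | /imsetP[k _ ->]].
  - rewrite nevD //=; apply/orP; right; apply/orP; left.
    by apply/bigcupP; exists i.
  - by rewrite nxD // eqxx.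
  - by rewrite yu yD !orbT.
apply: packsU => //.
- by rewrite disjoint_sym; apply: bigcup_disjoint => i _; rewrite disjoint_sym.
- by apply: (@packs_tiles V EB T E V_gt0 'I_s1 S) => // i; apply: bigcup_sup.
- exact: packs1 tK _.
Qed.

End Gadget.

(** The averaging condition for one exchange: [u] bounds the vertices unfit to be exposed, the next
    two terms those unfit for the roles [z] and [y], and [q] counts the copies already in use. With
    [Q = s1 * s * r <= n / 65] the left side is at most [n / 8 + 12 * Q], while the right side
    exceeds [n / 2 - Q]. *)
Lemma labelling_budget (s1 s2 s r n p q u : nat) :
  2 <= s1 -> 0 < s -> s2 <= s ->
  s * p + r = n -> 65 * s1 * s * r <= n -> 2 * s ^ 2 * s1.+1 < n ->
  q <= (s - 1) * s1.+1 + s1 -> 8 * s * u <= 8 * s * (16 * s * r) + (s - 1) * n ->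
  u + (s1 * (2 * s * r) + s2.-1 * (s1 * (2 * r))) < s * (p - q).
Proof.
move=> s1_ge2 s_gt0 s2_le hp hr hn hq hu.
set Q := s1 * s * r.
have hQ : 65 * Q <= n by apply: leq_trans hr; rewrite /Q; lia.
have hrQ : r <= Q by rewrite /Q -{1}[r]mul1n leq_mul2r muln_gt0 s_gt0 (ltn_trans _ s1_ge2) // orbT.
have hs1 : s1 * (2 * s * r) = 2 * Q by rewrite /Q; lia.
have hs2 : s2.-1 * (s1 * (2 * r)) <= 2 * Q.
  have : s2.-1 * (s1 * r) <= s * (s1 * r) by rewrite leq_mul2r; apply/orP; right; lia.
  rewrite /Q; lia.
have hsr : 2 * (s * r) <= Q by rewrite /Q -mulnA leq_mul2r s1_ge2 orbT.
have hu' : 8 * u <= 64 * Q + n.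
  rewrite -(leq_pmul2l s_gt0); apply: (@leq_trans (8 * s * (16 * s * r) + (s - 1) * n)); first lia.
  have : s * (2 * (s * r)) <= s * Q by rewrite leq_mul2l hsr orbT.
  have : (s - 1) * n <= s * n by rewrite leq_mul2r; apply/orP; right; lia.
  lia.
have hsq : s * q <= s ^ 2 * s1.+1.
  rewrite expnS expn1 -mulnA leq_mul2l; apply/orP; right; apply: leq_trans hq _.
  have -> : s * s1.+1 = (s - 1) * s1.+1 + s1.+1 by rewrite -mulSnr subn1 prednK.
  lia.
rewrite mulnBr; move: hsq hn.
rewrite -mulnA; move: (s ^ 2 * _) (s * q) (s * p) hp => a b c; lia.
Qed.

(** * Exchanging one rich vertex *)

Section Absorption.

Variables (s1 s2 : nat) (V : finType) (W1 W2 : {set V}) (EB : {set {set V}}).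
Hypothesis bipB : bipartite_graph s1 s2 W1 W2 EB.
Hypotheses (s1_ge2 : 2 <= s1) (s12 : s1 <= s2).
Variables (T : finType) (E : {set {set T}}) (P : {set {set T}}) (r n : nat).
Hypothesis tP : trivIset P.
Hypothesis tiles_P : {in P, forall S : {set T}, tile EB E S}.

Local Notation s := (s1 + s2).
Local Notation C := (cover P).
Local Notation m v := #|nonnbrs E C v|.

(** At most [n / (8 * s)] non-neighbours each, so fewer than [s] such vertices rule out less than
    [n / 8] candidates for the next exposed vertex. *)
Definition low_deficit : {set T} := [set v in C | 8 * s * m v <= n].

(** The thresholds come from [m <= 2 * d] and [d <= r], for the vertex and for its whole copy. The
    first limits the choices lost for the [y k], which must be adjacent to [v]; the second those
    lost for the [z] that replaces [v] in its copy. *)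
Definition good : {set T} :=
  [set v in C | (m v <= 2 * r) && (\sum_(a in pblock P v) m a <= 2 * s * r)].

(* [s ^ 2 * s1.+1] good neighbours meet [s * s1.+1] copies, so [s1] of these remain
   untouched as long as fewer than [s] exchanges, each using [s1.+1] copies, were made. *)
Definition rich : {set T} :=
  [set x in ~: C | s ^ 2 * s1.+1 <= #|[set v in good | [set v; x] \in E]|].

Hypotheses (order_n : s * #|P| + r = n) (r_small : 65 * s1 * s * r <= n).
Hypothesis n_large : 2 * s ^ 2 * s1.+1 < n.
Hypothesis few_high : #|C :\: low_deficit| <= 16 * s * r.

Lemma card_block (A : {set T}) : A \in P -> #|A| = s.
Proof. by move/tiles_P/card_tile ->; rewrite (bip_card bipB). Qed.

Lemma nonnbrs_adj (a w : T) :
  w \in C -> w != a -> w \notin nonnbrs E C a -> [set a; w] \in E.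
Proof. by move=> wC nwa; rewrite inE wC nwa /= negbK. Qed.

(** Pigeonhole: a copy has only [s] vertices, so the good neighbours of [x] meet at least
    [s * s1.+1] copies, of which at least [s1.+1] lie outside [Q]. *)
Lemma fresh_neighbours (Q : {set {set T}}) (x : T) :
  #|Q| <= (s - 1) * s1.+1 -> x \in rich ->
  exists (A : 'I_s1 -> {set T}) (v : 'I_s1 -> T),
    [/\ injective A, forall i, A i \in P :\: Q, forall i, v i \in A i,
        forall i, v i \in good & forall i, [set v i; x] \in E].
Proof.
have s_gt0 : 0 < s by rewrite addn_gt0 (ltnW s1_ge2).
move=> cQ; rewrite inE => /andP[_ cN].
set N := [set v in good | _] in cN.
have NC v : v \in N -> v \in C by rewrite !inE => /andP[/andP[]].
pose BN : {set {set T}} := pblock P @: N.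
have sBN : BN \subset P.
  by apply/subsetP => _ /imsetP[v /NC vC ->]; apply: pblock_mem.
have cNB : #|N| <= s * #|BN|.
  apply: (@leq_trans #|\bigcup_(A in BN) A|).
    apply/subset_leq_card/subsetP => v vN; apply/bigcupP; exists (pblock P v).
      exact: imset_f.
    by rewrite mem_pblock NC.
  apply: leq_trans (card_bigcup_leq _ _) _.
  rewrite (eq_bigr (fun=> s)) => [|A /(subsetP sBN)]; last exact: card_block.
  by rewrite sum_nat_const mulnC.
have cBN : s * s1.+1 <= #|BN|.
  by rewrite -(leq_pmul2l s_gt0) mulnA mulnn; apply: leq_trans cNB.
have [AA sAA cAA] : exists2 AA : {set {set T}}, AA \subset BN :\: Q & #|AA| = s1.
  apply: exists_subset_card; rewrite cardsD.
  have : #|BN :&: Q| <= #|Q| by apply/subset_leq_card/subsetIr.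
  have : s * s1.+1 = (s - 1) * s1.+1 + s1.+1 by rewrite -mulSnr subn1 prednK.
  move=> es; rewrite es in cBN; move: cQ cBN; move: ((s - 1) * _) => k; clear; lia.
pose A (i : 'I_s1) : {set T} := enum_val (cast_ord (esym cAA) i).
have AAA i : A i \in AA by apply: enum_valP.
have ABQ i : A i \in BN :\: Q by apply: (subsetP sAA).
have vP i : exists v, v \in N /\ A i = pblock P v.
  by have := ABQ i; rewrite inE => /andP[_ /imsetP[v vN ->]]; exists v.
have [v vN] := fin_all_exists vP.
exists A, v; split.
- by move=> i j /enum_val_inj /cast_ord_inj.
- by move=> i; have := ABQ i; rewrite !inE => /andP[-> /(subsetP sBN)].
- by move=> i; have [vNi ->] := vN i; rewrite mem_pblock NC.
- by move=> i; have [] := vN i; rewrite inE => /andP[].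
- by move=> i; have [] := vN i; rewrite inE => /andP[].
Qed.

(** One step of the exchange process: [Q] holds the copies used so far and [U] the vertices exposed
    so far. The new copies [Q'] are the [A i] and [D]; taking [u] of low deficit keeps the later
    steps possible. *)
Lemma absorb (Q : {set {set T}}) (U : {set T}) (x : T) :
  Q \subset P -> #|Q| <= (s - 1) * s1.+1 -> U \subset cover Q ->
  U \subset low_deficit -> #|U| < s -> x \in rich ->
  exists (Q' : {set {set T}}) (u : T),
    [/\ Q' \subset P :\: Q, #|Q'| = s1.+1, u \in cover Q' :&: low_deficit,
        forall a, a \in U -> [set a; u] \in E
      & packs EB E s1.+1 ((x |: cover Q') :\ u)].
Proof.
move=> sQP cQ UQ Ulow cU x_rich.
have [A [v [A_inj APQ vA v_good vx]]] := fresh_neighbours cQ x_rich.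
have AP i : A i \in P by have := APQ i; rewrite inE => /andP[].
have xC : x \notin C by move: x_rich; rewrite !inE => /andP[].
have blockC (S : {set T}) a : S \in P -> a \in S -> a \in C.
  by move=> SP aS; apply/bigcupP; exists S.
(* The vertices unfit for each role: [z i] must see the copy [A i] apart from [v i], each [y k] must
   see all [v i], and [u] must have low deficit and see all of [U]. *)
pose zbad i := \bigcup_(a in A i) nonnbrs E C a.
pose ybad := \bigcup_(i in [set: 'I_s1]) nonnbrs E C (v i).
pose ubad := (C :\: low_deficit) :|: \bigcup_(a in U) nonnbrs E C a.
have c_zbad i : #|zbad i| <= 2 * s * r.
  apply: leq_trans (card_bigcup_leq _ _) _.
  rewrite -(def_pblock tP (AP i) (vA i)).
  by have := v_good i; rewrite inE => /and3P[].
have c_ybad : #|ybad| <= s1 * (2 * r).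
  apply: leq_trans (card_bigcup_leq _ _) _.
  rewrite -[s1 in s1 * _]card_ord -cardsT -sum_nat_const.
  by apply: leq_sum => i _; have := v_good i; rewrite inE => /and3P[].
have c_ubad : 8 * s * #|ubad| <= 8 * s * (16 * s * r) + (s - 1) * n.
  apply: (@leq_trans (8 * s * (#|C :\: low_deficit| + \sum_(a in U) m a))).
    rewrite leq_mul2l; apply/orP; right; apply: leq_trans (leq_card_setU _ _) _.
    by rewrite leq_add2l card_bigcup_leq.
  rewrite mulnDr leq_add // ?leq_mul2l ?few_high ?orbT //.
  apply: (@leq_trans (#|U| * n)); last by rewrite leq_mul2r; apply/orP; right; move: cU; clear; lia.
  rewrite big_distrr -sum_nat_const; apply: leq_sum => a /(subsetP Ulow).
  by rewrite inE => /andP[].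
(* Roles are numbered with the [s1] values of [z] first, then the [s2.-1] values of [y], and [u]
   last: [s] in all, the size of a block. *)
pose bad (i : 'I_(s1 + s2.-1).+1) :=
  if unlift ord_max i is Some j then
    match split j with inl k => zbad k | inr _ => ybad end
  else ubad.
pose iz (i : 'I_s1) : 'I_(s1 + s2.-1).+1 := lift ord_max (lshift s2.-1 i).
pose iy (k : 'I_s2.-1) : 'I_(s1 + s2.-1).+1 := lift ord_max (rshift s1 k).
have bad_z i : bad (iz i) = zbad i.
  by rewrite /bad liftK (unsplitK (inl i)).
have bad_y k : bad (iy k) = ybad.
  by rewrite /bad liftK (unsplitK (inr k)).
have bad_u : bad ord_max = ubad by rewrite /bad unlift_none.
pose AA := [set A i | i : 'I_s1].
have cAA : #|AA| = s1 by rewrite card_imset // card_ord.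
have s1_gt0 : 0 < s1 := ltnW s1_ge2.
have s2_gt0 : 0 < s2 := leq_trans s1_gt0 s12.
have s_gt0 : 0 < s by rewrite addn_gt0 s1_gt0.
have eqs : (s1 + s2.-1).+1 = s by rewrite -addnS prednK.
pose P' := P :\: (Q :|: AA).
have sP' : P' \subset P by apply: subsetDl.
have cP' : #|P| - (#|Q| + s1) <= #|P'|.
  rewrite cardsD leq_sub2l //; apply: leq_trans (subset_leq_card (subsetIr _ _)) _.
  by rewrite -[X in _ <= _ + X]cAA; apply: leq_card_setU.
have [|||D [w [DP' w_inj wD w_bad]]] := @cyclic_labelling T (s1 + s2.-1) P' bad.
- exact: trivIsetS sP' tP.
- by move=> S /(subsetP sP') /card_block ->; rewrite eqs.
- rewrite (bigD1_ord ord_max) //= bad_u big_split_ord /=.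
  apply: (@leq_ltn_trans (#|ubad| + (s1 * (2 * s * r) + s2.-1 * (s1 * (2 * r))))).
    rewrite leq_add2l; apply: leq_add.
      apply: (@leq_trans (\sum_(i < s1) 2 * s * r)); last by rewrite sum_nat_const card_ord.
      by apply: leq_sum => i _; rewrite [bad _]bad_z.
    apply: (@leq_trans (\sum_(k < s2.-1) s1 * (2 * r))); last by rewrite sum_nat_const card_ord.
    by apply: leq_sum => k _; rewrite [bad _]bad_y.
  rewrite eqs; apply: leq_trans (leq_mul (leqnn _) cP').
  apply: (labelling_budget s1_ge2 s_gt0 (leq_addl s1 s2) order_n r_small n_large) => //.
  by rewrite leq_add2r.
have [DP DQ DA] : [/\ D \in P, D \notin Q & forall i, A i != D].
  move: DP'; rewrite !inE negb_or => /andP[/andP[DQ DAA] DP]; split=> // i.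
  by apply: contraNneq DAA => <-; apply: imset_f.
have neAD i a b : a \in A i -> b \in D -> b != a.
  move=> aA bD; apply/eqP => eq; have := DA i.
  by rewrite (trivIset_eq tP (AP i) DP aA) ?eqxx // -eq.
have wC i : w i \in C by apply: (blockC D).
pose Q' := D |: AA.
have cover_Q' : cover Q' = \bigcup_i A i :|: D.
  by rewrite /cover big_setU1 /= ?big_imset //= 1?setUC // => [i j _ _ /A_inj //|];
     apply/negP => /imsetP[i _ e]; have := DA i; rewrite e eqxx.
exists Q', (w ord_max); split.
- apply/subsetP => S; rewrite inE => /orP[|/imsetP[i _ ->]]; last exact: APQ.
  by rewrite inE => /eqP ->; rewrite inE DQ.
- rewrite cardsU1 cAA (_ : D \notin AA) //.
  by apply/negP => /imsetP[i _ e]; have := DA i; rewrite e eqxx.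
- rewrite inE cover_Q' inE wD orbT /=.
  by have := w_bad ord_max; rewrite bad_u !inE negb_or wC andbT negbK => /andP[].
- move=> a aU; have := w_bad ord_max; rewrite bad_u inE negb_or => /andP[_ nb].
  apply: nonnbrs_adj => //; last by apply: contra nb => ?; apply/bigcupP; exists a.
  apply/eqP => e; have /bigcupP[S SQ aS] := subsetP UQ a aU.
  by move: DQ; rewrite -(trivIset_eq tP (subsetP sQP _ SQ) DP aS) ?SQ // -e.
rewrite cover_Q'.
apply: (@gadget s1 s2 V W1 W2 EB bipB s1_gt0 s2_gt0 T E P A D v (w \o iz) (w \o iy)) => //.
- by move=> i j /w_inj /lift_inj /lshift_inj.
- by move=> i j /w_inj /lift_inj /rshift_inj.
- by move=> i k; rewrite (inj_eq w_inj) (inj_eq lift_inj) eq_lrshift.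
- by move=> i; rewrite (inj_eq w_inj) eq_sym neq_lift.
- by move=> i; rewrite (inj_eq w_inj) eq_sym neq_lift.
- by move=> i; apply: wD.
- by move=> i; apply: wD.
- move=> i a aA nav; rewrite setUC; apply: nonnbrs_adj; rewrite /= ?wC ?(neAD i) //.
  by have := w_bad (iz i); rewrite bad_z; apply: contra => ?; apply/bigcupP; exists a.
- move=> i k; apply: nonnbrs_adj; rewrite /= ?wC ?(neAD i) //.
  have := w_bad (iy k); rewrite bad_y; apply: contra => ?; apply/bigcupP.
  by exists i; first exact: in_setT.
Qed.

End Absorption.

(** * Iterated exchanges and the extra copy *)

Lemma cover_setU (T : finType) (P Q : {set {set T}}) :
  cover (P :|: Q) = cover P :|: cover Q.
Proof. by rewrite /cover bigcup_setU. Qed.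

Lemma cover_sub (T : finType) (P Q : {set {set T}}) :
  P \subset Q -> cover P \subset cover Q.
Proof.
move=> sPQ; apply/subsetP => x /bigcupP[A AP xA]; apply/bigcupP; exists A => //.
exact: (subsetP sPQ).
Qed.

Lemma trivIset_cover_disjoint (T : finType) (P Q1 Q2 : {set {set T}}) (x : T) :
  trivIset P -> Q1 \subset P -> Q2 \subset P :\: Q1 ->
  x \in cover Q1 -> x \in cover Q2 -> False.
Proof.
move=> tP s1 s2 /bigcupP[A AQ xA] /bigcupP[B BQ xB].
have := subsetP s2 B BQ; rewrite inE => /andP[/negP nBQ BP]; apply: nBQ.
by rewrite -(trivIset_eq tP (subsetP s1 A AQ) BP xA xB).
Qed.

Section Count.

Variables (s1 s2 : nat) (V : finType) (W1 W2 : {set V}) (EB : {set {set V}}).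
Hypothesis bipB : bipartite_graph s1 s2 W1 W2 EB.
Hypotheses (s1_ge2 : 2 <= s1) (s12 : s1 <= s2).
Variables (T : finType) (E : {set {set T}}) (P : {set {set T}}) (r n : nat).
Hypothesis tP : trivIset P.
Hypothesis tiles_P : {in P, forall S : {set T}, tile EB E S}.

Local Notation s := (s1 + s2).
Local Notation C := (cover P).
Local Notation m v := #|nonnbrs E C v|.
Local Notation d v := #|nbrs E (~: C) v|.
Local Notation low := (low_deficit s1 s2 E P n).
Local Notation good := (good s1 s2 E P r).
Local Notation rich := (rich s1 s2 E P r).

Hypotheses (order_n : s * #|P| + r = n) (r_small : 65 * s1 * s * r <= n).
Hypothesis n_large : 2 * s ^ 2 * s1.+1 < n.

(** Induction on [#|X|]. Each exchange uses copies untouched by the earlier ones, so the packings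
    add up, and each exposed vertex is adjacent to its predecessors, so [U] remains a clique. *)
Lemma absorb_all (X : {set T}) :
  #|C :\: low| <= 16 * s * r -> X \subset rich -> #|X| <= s ->
  exists (Q : {set {set T}}) (U : {set T}),
    [/\ Q \subset P, #|Q| = #|X| * s1.+1, U \subset cover Q :&: low,
        #|U| = #|X| /\ {in U &, forall x y, x != y -> [set x; y] \in E}
      & packs EB E (#|X| * s1.+1) ((X :|: cover Q) :\: U)].
Proof.
move=> few_high; have [k] := ubnP #|X|; elim: k => // k IH in X * => ltk sX cX.
have [->|/set0Pn [x xX]] := eqVneq X set0.
  exists set0, set0; split; rewrite ?sub0set ?cards0 //.
    by split=> // a b; rewrite inE.
  exists set0; split; rewrite ?cards0 //.
  - by apply/trivIsetP => A B; rewrite inE.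
  - by rewrite /cover big_set0 sub0set.
  - by move=> S; rewrite inE.
have cX' : #|X| = (#|X :\ x|).+1 by rewrite (cardsD1 x) xX.
have [||| Q [U [sQ cQ sU [cU Ucl] pQ]]] := IH (X :\ x).
- by rewrite -ltnS -cX'.
- exact: subset_trans (subsetDl _ _) sX.
- by apply: leq_trans cX; rewrite cX'.
move: sU; rewrite subsetI => /andP[sUQ sUlow].
have xr := subsetP sX x xX.
have inXC a : a \in X -> a \notin C.
  by move=> /(subsetP sX); rewrite !inE => /andP[].
have cQ_le : #|Q| <= (s - 1) * s1.+1.
  by rewrite cQ leq_mul2r; apply/orP; right; move: cX cX'; clear; lia.
have cU_lt : #|U| < s by rewrite cU -cX'.
have [Q' [u [sQ' cQ' uQ' Uu pQ']]] :=
  absorb bipB s1_ge2 s12 tP tiles_P order_n r_small n_large few_high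
    sQ cQ_le sUQ sUlow cU_lt xr.
move: uQ'; rewrite inE => /andP[uQ' ulow].
have sQ'P : Q' \subset P := subset_trans sQ' (subsetDl _ _).
have dQ := trivIset_cover_disjoint tP sQ sQ'.
have QC := subsetP (cover_sub sQ); have Q'C := subsetP (cover_sub sQ'P).
have uU : u \notin U by apply/negP => /(subsetP sUQ) /dQ; apply.
exists (Q :|: Q'), (u |: U); split.
- by rewrite subUset sQ.
- rewrite cardsU cQ cQ' (_ : Q :&: Q' = set0) ?cards0.
    by rewrite cX' mulSn subn0 addnC.
  apply/setP => A; rewrite !inE; apply/negP => /andP[AQ /(subsetP sQ')].
  by rewrite inE AQ.
- rewrite cover_setU; apply/subsetP => a; rewrite !inE => /orP[/eqP -> | aU].
    by rewrite uQ' orbT; move: ulow; rewrite inE.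
  by rewrite (subsetP sUQ _ aU); have := subsetP sUlow _ aU; rewrite inE.
- split; first by rewrite cardsU1 uU cU cX'.
  move=> a b; rewrite !inE => /orP[/eqP -> | aU] /orP[/eqP -> | bU]; rewrite ?eqxx //.
  + by rewrite setUC Uu.
  + by rewrite Uu.
  + exact: Ucl.
rewrite cX' mulSn addnC.
(* [Q] and [Q'] share no vertex and [X] lies outside [C], so the old and the new packing occupy
   disjoint regions, and neither region meets [u |: U]. *)
apply: (@packs_sub _ _ _ _ _ ((((X :\ x) :|: cover Q) :\: U) :|: ((x |: cover Q') :\ u))).
  rewrite cover_setU; apply/subsetP => a; rewrite !inE.
  case/orP=> /andP[na]; first case/orP=> [/andP[nax aX]|aQ].
  - rewrite aX (negPf na) orbF andbT; apply: contraNneq (inXC _ aX) => ->.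
    exact: Q'C.
  - rewrite aQ orbT (negPf na) orbF andbT; apply/eqP => e.
    by apply: (dQ a); rewrite // e.
  case/orP=> [/eqP ax | aQ'].
    rewrite ax xX andbT -ax (negPf na) /=; apply: contra (inXC _ xX).
    by rewrite -ax => /(subsetP sUQ) /QC.
  rewrite aQ' !orbT andbT (negPf na) /=; apply/negP => /(subsetP sUQ) aQ.
  exact: (dQ a).
apply: packsU => //; first by rewrite (bip_card bipB) addn_gt0 (ltnW s1_ge2).
rewrite -setI_eq0; apply/eqP/setP => a; rewrite !inE; apply/negP.
case/andP=> /andP[_ H1] /andP[_ H2].
case/orP: H1 => [/andP[nax aX]|aQ]; case/orP: H2 => [/eqP ax|aQ'].
- by rewrite ax eqxx in nax.
- by move: (inXC _ aX); rewrite (Q'C _ aQ').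
- by move: (inXC _ xX); rewrite -ax (QC _ aQ).
- exact: (dQ a).
Qed.

(** After [s] exchanges the untouched copies and the rebuilt ones are as many as [P], and the [s]
    exposed vertices form a clique, which carries one more copy. *)
Lemma extra_tile :
  #|C :\: low| <= 16 * s * r -> s <= #|rich| -> packs EB E #|P|.+1 setT.
Proof.
move=> few_high /exists_subset_card[X sX cX].
have [|Q [U [sQ cQ]]] := absorb_all few_high sX; first by rewrite cX.
rewrite cX subsetI => /andP[sUQ _] [cU Ucl] pQ.
have V_gt0 : 0 < #|V| by rewrite (bip_card bipB) addn_gt0 (ltnW s1_ge2).
have inXC a : a \in X -> a \notin C.
  by move=> /(subsetP sX); rewrite !inE => /andP[].
have tU : tile EB E U by apply: (tile_clique bipB) => //; exact: ltnW.
have pU := packs1 V_gt0 tU (subxx U).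
have pR : packs EB E #|P :\: Q| (cover (P :\: Q)).
  exists (P :\: Q); split=> //; first exact: trivIsetS (subsetDl _ _) tP.
  by move=> S; rewrite inE => /andP[_ /tiles_P].
have dQ := trivIset_cover_disjoint tP sQ (subxx (P :\: Q)).
have -> : #|P|.+1 = #|P :\: Q| + s * s1.+1 + 1.
  rewrite addn1 cardsD (setIidPr sQ) -cX -cQ subnK //.
  exact: subset_leq_card.
apply: packs_sub (subsetT _) (packsU V_gt0 _ (packsU V_gt0 _ pR pQ) pU).
  rewrite -setI_eq0; apply/eqP/setP => a; rewrite !inE; apply/negP.
  case/andP=> /orP[aR | /andP[/negP na _]] aU //.
  by apply: (dQ a) => //; apply: (subsetP sUQ).
rewrite -setI_eq0; apply/eqP/setP => a; rewrite !inE; apply/negP.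
case/andP=> aR /andP[_ /orP[aX | aQ]]; last exact: (dQ a).
by move: (inXC _ aX); rewrite (subsetP (cover_sub (subsetDl _ _)) _ aR).
Qed.

(** * Consequences of an excess of edges between [C] and its complement *)

Hypothesis card_T : #|T| = n.
(** The form in which a failure of the edge bound is exploited; the derivation is in
    [saturated_bound]. *)
Hypothesis excess : 2 * (s1 * s * n) + \sum_(v in C) m v < 2 * \sum_(v in C) d v.

Lemma card_cover_tiles : #|C| = s * #|P|.
Proof.
rewrite -(eqP tP) (eq_bigr (fun=> s)); last by move=> A; apply: (card_block bipB tiles_P).
by rewrite sum_nat_const mulnC.
Qed.

Lemma card_coverC : #|~: C| = r.
Proof. by apply/(@addnI #|C|); rewrite cardsC card_T card_cover_tiles. Qed.

Lemma deg_rest_leq v : d v <= r.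
Proof. by rewrite -card_coverC; apply/subset_leq_card/nbrs_sub. Qed.

(** By [excess], the total of [m] over [C] is below twice the total of [d], hence at most
    [2 * n * r]; each vertex outside [low] contributes more than [n / (8 * s)] to it. *)
Lemma few_high_deficit : #|C :\: low| <= 16 * s * r.
Proof.
have n_gt0 : 0 < n by apply: leq_ltn_trans n_large.
have cC : #|C| <= n by rewrite card_cover_tiles -order_n leq_addr.
have sum_d : \sum_(v in C) d v <= n * r.
  apply: (@leq_trans (\sum_(v in C) r)); first by apply: leq_sum => v _; apply: deg_rest_leq.
  by rewrite sum_nat_const leq_mul2r cC orbT.
rewrite -(leq_pmul2r n_gt0).
apply: (@leq_trans (8 * s * \sum_(v in C) m v)).
  rewrite -sum_nat_const big_distrr /= [X in _ <= X](big_setID low) /=.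
  apply: leq_trans _ (leq_addl _ _); apply: leq_sum => v.
  by rewrite !inE => /andP[]; case: (v \in C) => //=; rewrite -ltnNge => /ltnW.
apply: (@leq_trans (8 * s * (2 * (n * r)))); last by clear; lia.
rewrite leq_mul2l; apply/orP; right.
apply: leq_trans (leq_trans (ltnW excess) _); first exact: leq_addl.
by rewrite leq_mul2l sum_d orbT.
Qed.

(** Copies in which [2 * d] sums to at most [m] are discarded, and in the other copies the single
    vertices with [2 * d < m]. What is discarded is paid for by the total of [m], and every
    surviving vertex is good because [d <= r]. *)
Lemma sum_good : s1 * s * n < \sum_(v in good) d v.
Proof.
pose f v := if v \in good then 2 * d v else 0.
have fE : \sum_(v in C) f v = 2 * \sum_(v in good) d v.
  rewrite big_distrr /= -big_mkcondr /=; apply: eq_bigl => v.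
  by rewrite inE andbA andbb.
have : \sum_(v in C) 2 * d v <= \sum_(v in C) m v + \sum_(v in C) f v.
  rewrite -big_split /= !big_trivIset //=; apply: leq_sum => A AP.
  have [le_dm|lt_md] := leqP (\sum_(v in A) 2 * d v) (\sum_(v in A) m v).
    apply: leq_trans le_dm _; apply: leq_sum => v _; exact: leq_addr.
  apply: leq_sum => v vA; have [le_m | /ltnW lt] := leqP (m v) (2 * d v); last first.
    by apply: leq_trans lt _; apply: leq_addr.
  suff vg : v \in good by rewrite /f vg leq_addl.
  have vC : v \in C by apply/bigcupP; exists A.
  rewrite inE vC (def_pblock tP AP vA) /=; apply/andP; split.
    by apply: leq_trans le_m _; rewrite leq_mul2l deg_rest_leq orbT.
  apply: leq_trans (ltnW lt_md) _.
  apply: (@leq_trans (\sum_(v in A) 2 * r)).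
    by apply: leq_sum => w _; rewrite leq_mul2l deg_rest_leq orbT.
  by rewrite sum_nat_const (card_block bipB tiles_P AP) mulnCA mulnA.
rewrite fE -big_distrr /=; move: excess.
move: (s1 * s * n) (\sum_(v in C) _) (\sum_(v in C) _) (\sum_(v in good) _) => a b c e; clear; lia.
Qed.

(** Counted from outside [C], a rich vertex receives at most [n] edges from [good] and any other at
    most [K]. With fewer than [s] rich vertices the total would be below [s * n + r * K <= 2 * (s *
    n) <= s1 * s * n], against [sum_good]. *)
Lemma many_rich : s <= #|rich|.
Proof.
have n_gt0 : 0 < n by apply: leq_ltn_trans n_large.
set K := s ^ 2 * s1.+1.
have := sum_good; rewrite double_count.
have le_sum : \sum_(x in ~: C) #|[set v in good | [set v; x] \in E]|
    <= #|rich| * n + r * K.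
  apply: (@leq_trans (\sum_(x in ~: C) ((if x \in rich then n else 0) + K))).
    apply: leq_sum => x xC; rewrite [x \in rich]inE xC /=.
    case: (leqP (s ^ 2 * _) _) => [_|/ltnW //]; apply: leq_trans _ (leq_addr _ _).
    by rewrite -card_T; apply: max_card.
  rewrite big_split /= sum_nat_const card_coverC leq_add2r -big_mkcondr /=.
  rewrite -sum_nat_const; apply: eq_leq; apply: eq_bigl => x.
  by rewrite [x \in rich]inE andbA andbb.
move=> /leq_trans /(_ le_sum) => lt; rewrite leqNgt; apply/negP => rich_small.
(* From [s1.+1 <= 2 * s1], [r * K] is at most [2 * s] times [s1 * s * r], which [r_small]
   controls. *)
have rK : r * K <= s * n.
  apply: (@leq_trans (s * (2 * (s1 * s * r)))); last first.
    by rewrite leq_mul2l; apply/orP; right; apply: leq_trans r_small; clear; lia.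
  apply: (@leq_trans (r * (s ^ 2 * (2 * s1)))); last by rewrite expnS expn1; clear; lia.
  by rewrite /K !leq_mul2l; apply/orP; right; apply/orP; right; move: s1_ge2; clear; lia.
have h1 : #|rich| * n + n <= s * n by rewrite -mulSnr leq_mul2r rich_small orbT.
have h2 : 2 * (s * n) <= s1 * s * n by rewrite -mulnA leq_mul2r s1_ge2 orbT.
by move: h1 h2 lt rK; clear; lia.
Qed.

End Count.

(** * Saturation and the final edge count *)

Lemma double_bin2 k : 2 * 'C(k, 2) = k * k.-1.
Proof. by rewrite -[in RHS](bin1 k.-1) mul_bin_diag. Qed.

Lemma card_graph_leq (T : finType) (E : {set {set T}}) :
  is_graph E -> #|E| <= 'C(#|T|, 2).
Proof.
move=> gE; rewrite -(leq_pmul2l (m := 2)) // double_bin2 -subn1 -cardsT.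
by rewrite -(card_induced gE) (induced_setT E) leq_addr.
Qed.

Section Extremal.

Variables (s1 s2 : nat) (V : finType) (W1 W2 : {set V}) (EB : {set {set V}}).
Hypothesis bipB : bipartite_graph s1 s2 W1 W2 EB.
Hypotheses (s1_ge2 : 2 <= s1) (s12 : s1 <= s2).

Local Notation s := (s1 + s2).

Let s1_gt0 : 0 < s1 := ltnW s1_ge2.
Let V_gt0 : 0 < #|V|.
Proof. by rewrite (bip_card bipB) addn_gt0 s1_gt0. Qed.

Lemma complete_packs (T : finType) (E : {set {set T}}) k (X : {set T}) :
  (forall x y : T, x != y -> [set x; y] \in E) -> s * k <= #|X| -> packs EB E k X.
Proof.
move=> cE; elim: k X => [|k IH] X.
  move=> _; exists set0; split; rewrite ?cards0 //.
  - by apply/trivIsetP => A B; rewrite inE.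
  - by rewrite /cover big_set0 sub0set.
  - by move=> S; rewrite inE.
rewrite mulnS => cX; have [U sU cU] := exists_subset_card (leq_trans (leq_addr _ _) cX).
rewrite -(setID X U) (setIidPr sU) -add1n; apply: packsU => //.
- by rewrite disjoint_sym disjoints_subset setDE subsetIr.
- apply: (packs1 V_gt0 (S := U)) => //; apply: (tile_clique bipB) => //.
  by move=> x y _ _; apply: cE.
- by apply: IH; rewrite cardsD (setIidPr sU) cU leq_subRL // (leq_trans (leq_addr _ _) cX).
Qed.

(** Some tile of the packing depends on [e] and therefore contains it. The other tiles are disjoint
    from that one, so they survive the removal of [e]. *)
Lemma packs_remove_edge (T : finType) (E : {set {set T}}) (e : {set T}) k :
  #|e| = 2 -> packs EB (e |: E) k.+1 setT -> ~ packs EB E k.+1 setT ->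
  packs EB E k setT.
Proof.
move=> ce [P [cP tP _ PP]] nP.
have [S SP nS] : exists2 S, S \in P & ~~ tile EB E S.
  apply/exists_inP; rewrite -[X in is_true X]negbK negb_exists_in.
  apply/negP => /forall_inP all_tile; apply: nP; exists P; split=> //.
  by move=> S /all_tile /negPn.
have eS : e \subset S.
  have /tileP[f /andP[f_inj /forall_inP fE] eS] := PP S SP.
  have : ~~ [forall e' in EB, f @: e' \in E].
    apply: contra nS => H; apply/tileP; exists f => //.
    by rewrite /is_copy f_inj.
  rewrite negb_forall_in => /exists_inP[e' e'B nE].
  have := fE _ e'B; rewrite in_setU1 (negPf nE) orbF => /eqP <-.
  by rewrite eS; apply/subsetP => _ /imsetP[x _ ->]; apply: imset_f.
exists (P :\ S); split.
- by apply/eqP; rewrite -eqSS -cP (cardsD1 S P) SP.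
- exact: trivIsetS (subsetDl _ _) tP.
- exact: subsetT.
move=> S'; rewrite !inE => /andP[nSS S'P].
have /tileP[f /andP[f_inj /forall_inP fE] eS'] := PP S' S'P.
apply/tileP; exists f => //; rewrite /is_copy f_inj /=.
apply/forall_inP => e' e'B; have := fE _ e'B; rewrite in_setU1 => /orP[/eqP fe|//].
have /card_gt0P[x xe] : 0 < #|e| by rewrite ce.
have xS := subsetP eS x xe.
have xS' : x \in S'.
  rewrite eS'; move: xe; rewrite -fe => /imsetP[y _ ->]; exact: imset_f.
by move: nSS; rewrite (trivIset_eq tP S'P SP xS' xS) eqxx.
Qed.

(** Take an edge-maximal supergraph without [t.+1] disjoint copies. It is not complete, as a
    complete graph this large contains them; adding a missing edge creates [t.+1] copies, and taking
    the edge away again costs only one. *)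
Lemma saturate (T : finType) (E : {set {set T}}) t :
  is_graph E -> ~~ has_disjoint_copies t.+1 EB E -> s * t.+1 <= #|T| ->
  exists E' : {set {set T}},
    [/\ is_graph E', E \subset E', ~ packs EB E' t.+1 setT & packs EB E' t setT].
Proof.
move=> gE nE cT.
pose ok (E' : {set {set T}}) :=
  [&& is_graph E', E \subset E' & ~~ has_disjoint_copies t.+1 EB E'].
have okE : ok E by rewrite /ok gE subxx.
case: (arg_maxnP (fun E' : {set {set T}} => #|E'|) okE) => E' /and3P[gE' sE nE'] maxE'.
have noP : ~ packs EB E' t.+1 setT.
  by move/(@packs_disjoint_copies V EB T E' V_gt0); apply/negP.
exists E'; split=> //.
have [/forallP all_edge | ] :=
    boolP [forall x, forall y, (x != y) ==> ([set x; y] \in E')].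
  case: noP; apply: complete_packs; last by rewrite cardsT.
  by move=> x y; have /forallP /(_ y) /implyP := all_edge x.
rewrite negb_forall => /existsP[x]; rewrite negb_forall => /existsP[y].
rewrite negb_imply => /andP[nxy nxyE].
have cxy : #|[set x; y]| = 2 by rewrite cards2 nxy.
apply: (packs_remove_edge (e := [set x; y])) => //.
apply/(@packs_disjoint_copies V EB T _ V_gt0); apply: contraT => nE''.
suff /maxE' : ok ([set x; y] |: E') by rewrite /= cardsU1 nxyE add1n ltnn.
rewrite /ok nE'' andbT; apply/andP; split; last first.
  exact: subset_trans sE (subsetUr _ _).
apply/forall_inP => e; rewrite in_setU1 => /orP[/eqP -> | /(forall_inP gE') //].
by rewrite cxy.
Qed.

(** If the bound fails, splitting the edges into those inside [C], those outside and those across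
    forces [excess]; [extra_tile] then contradicts [noP]. *)
Lemma saturated_bound (T : finType) (E : {set {set T}}) t (n := #|T|) :
  is_graph E -> packs EB E t setT -> ~ packs EB E t.+1 setT ->
  s * t.+1 <= n -> 65 * s1 * s * (n - s * t) <= n -> 2 * s ^ 2 * s1.+1 < n ->
  #|E| <= 'C(s * t.+1 - 1, 2) + ex (n - s * t.+1 + 1) EB + s1 * s * n.
Proof.
move=> gE [P [cP tP _ PP]] noP st_n r_small n_large.
set r := n - s * t in r_small.
have st_le : s * t <= n by apply: leq_trans st_n; rewrite leq_mul2l leqnSn orbT.
have order_n : s * #|P| + r = n by rewrite cP subnKC.
rewrite leqNgt; apply/negP => large.
pose C := cover P.
have cC : #|C| = s * t by rewrite (card_cover_tiles bipB tP PP) cP.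
have cR : #|~: C| = r by apply: (card_coverC bipB tP PP order_n).
(* The complement of [C] has [r = n - s * t] vertices, [s - 1] more than the order in the [ex] term.
   Leaving those out costs at most [(s - 1) * r] edges. *)
have [R' sR' cR'] : exists2 R' : {set T}, R' \subset ~: C & #|R'| = n - s * t.+1 + 1.
  by apply: exists_subset_card; rewrite cR /r; move: st_n; rewrite mulnS; lia.
have ind_R' : #|induced E R'| <= ex (n - s * t.+1 + 1) EB.
  rewrite -cR'; apply: card_induced_ex => // S sS; apply/negP => tS; apply: noP.
  rewrite -addn1; apply: (@packs_sub _ _ _ _ _ (C :|: R')); first exact: subsetT.
  apply: packsU => //.
  - by rewrite disjoint_sym disjoints_subset.
  - by exists P.
  - exact: packs1 tS sS.
have ind_R := card_induced_leq gE sR'; rewrite cR cR' in ind_R.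
have ind_C := card_induced gE C; rewrite cC in ind_C.
have all_edges := card_induced_split gE C (~: C).
rewrite setUCr induced_setT in all_edges.
have excess : 2 * (s1 * s * n) + \sum_(v in C) #|nonnbrs E C v|
    < 2 * \sum_(v in C) #|nbrs E (~: C) v|.
  have s_gt0 : 0 < s by rewrite addn_gt0 s1_gt0.
  have le_rc : r <= s * t.
    have : 2 * r <= n.
      apply: leq_trans r_small; rewrite leq_mul2r; apply/orP; right.
      apply: (@leq_trans (65 * s1)); rewrite ?leq_pmulr //.
      exact: leq_trans (leq_pmulr 65 s1_gt0).
    by rewrite -[X in (_ <= X) -> _](subnKC st_le) mul2n -addnn leq_add2r.
  have eqN : s * t.+1 - 1 = s * t + (s - 1) by rewrite mulnS addnC addnBA.
  have eq_drop : r - (n - s * t.+1 + 1) = s - 1.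
    by rewrite /r; move: st_n s_gt0; rewrite mulnS; clear; lia.
  have drop_le : (s - 1) * r <= (s - 1) * (s * t) by rewrite leq_mul2l le_rc orbT.
  (* Doubled, this says that enlarging [s * t] by [s - 1] raises the binomial coefficient by at
     least [(s - 1) * (s * t)]; as [r <= s * t], this pays for the omitted vertices. *)
  have grow : s * t * (s * t - 1) + 2 * ((s - 1) * (s * t))
      <= (s * t + (s - 1)) * (s * t + (s - 1)).-1.
    by move: (s * t) (s - 1); clear => c k; nia.
  have := double_bin2 (s * t.+1 - 1); move: large ind_R; rewrite eq_drop eqN.
  move: grow drop_le ind_R' ind_C all_edges.
  move: ('C(_, _)) (s1 * s * n) (ex _ _) (_ * _.-1) (_ * (_ - 1)) => b l e f g.
  move: ((s - 1) * r) ((s - 1) * _) => h k; clear.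
  lia.
apply: noP; rewrite -cP; apply: (extra_tile bipB s1_ge2 s12 tP PP order_n) => //.
- exact: (few_high_deficit bipB tP PP order_n n_large erefl excess).
- exact: (many_rich bipB s1_ge2 tP PP order_n r_small n_large erefl excess).
Qed.

End Extremal.

(** * From the rational range of [t] to the theorem *)

Lemma rat_lower_bound_nat (s1 s n t : nat) : 0 < s1 -> 0 < s ->
  (n%:R / s%:R - n%:R / (65 * s1 * s ^ 2)%:R <= t%:R :> rat)%R ->
  65 * s1 * s * (n - s * t) <= n.
Proof.
move=> s1_gt0 s_gt0 lo.
set K := 65 * s1 * s.
have K_gt0 : 0 < K by rewrite !muln_gt0 s1_gt0.
have eD : 65 * s1 * s ^ 2 = K * s by rewrite /K -(mulnA (65 * s1)) mulnn.
rewrite {}eD in lo; move: K K_gt0 lo => K K_gt0 lo.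
(* Over the common denominator [K * s] the hypothesis reads [n * K <= t * (K * s) + n], that is,
   [K * (n - s * t) <= n]; the truncated difference is [0] when [s * t] exceeds [n]. *)
have eK : (n%:R / s%:R = (n * K)%:R / (K * s)%:R :> rat)%R.
  by rewrite !natrM invfM mulrA mulfK // pnatr_eq0 -lt0n.
move: lo; rewrite eK -mulrBl ler_pdivrMr ?ltr0n ?muln_gt0 ?K_gt0 // lerBlDr.
rewrite -natrM -natrD ler_nat => h.
by rewrite mulnBr leq_subLR mulnC (leq_trans h) // leq_add2r mulnC -mulnA.
Qed.

Theorem theorem1p16 (s1 s2 : nat) (V : finType) (W1 W2 : {set V})
  (EB : {set {set V}}) :
  2 <= s1 -> s1 <= s2 ->
  bipartite_graph s1 s2 W1 W2 EB ->
  exists n0 : nat, forall n : nat, n0 <= n ->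
    forall t : nat,
      ((n%:R / (s1 + s2)%:R - n%:R / (65 * s1 * (s1 + s2) ^ 2)%:R <= t%:R :> rat)
       && (t%:R <= n%:R / (s1 + s2)%:R :> rat))%R ->
      ex_disj n t.+1 EB <=
        'C((s1 + s2) * t.+1 - 1, 2) + ex (n - (s1 + s2) * t.+1 + 1) EB
        + s1 * (s1 + s2) * n.
Proof.
(* This [n0] makes fewer than [n / 2] vertices lie in copies consumed by the exchanges. *)
move=> s1_ge2 s12 bipB; exists (2 * (s1 + s2) ^ 2 * s1.+1).+1 => n n_large t t_range.
have s1_gt0 : 0 < s1 := ltnW s1_ge2.
have s_gt0 : 0 < s1 + s2 by rewrite addn_gt0 s1_gt0.
have /andP[/(rat_lower_bound_nat s1_gt0 s_gt0) r_small _] := t_range.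
apply/bigop.bigmax_leqP => E /andP[gE nE].
have [lt_n | ge_n] := ltnP n ((s1 + s2) * t.+1).
  (* Here [n <= s * t.+1 - 1], so the binomial term alone bounds the edges of any graph on [n]
     vertices. *)
  apply: (@leq_trans 'C(n, 2)); first by have := card_graph_leq gE; rewrite card_ord.
  by rewrite -addnA; apply: leq_trans (leq_addr _ _); apply: leq_bin2l; lia.
have [|E' [gE' sE nE' pE']] := saturate bipB s1_ge2 gE nE; first by rewrite card_ord.
apply: leq_trans (subset_leq_card sE) _.
by have := saturated_bound bipB s1_ge2 s12 gE' pE' nE'; rewrite !card_ord; apply.
Qed.
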